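(* Let $K$ be the transition kernel of a Markov chain on a general measurable state space $(\mathcal X,\mathcal B(\mathcal X))$ that is reversible with respect to a probability measure $\pi$. Let $\mu_0\ll\pi$ be an initial distribution with $\chi(\mu_0\|\pi)<\infty$, let $h_0=d\mu_0/d\pi$, and let $\mu_n$ be the law of the chain after $n$ steps. Then for all $n\in\mathbb N$, $$\chi(\mu_n\|\pi)^2\ge\chi(\mu_0\|\pi)^2\Big(1-\frac{\mathcal E_{K^2}(h_0,h_0)}{\chi(\mu_0\|\pi)^2}\Big)^n.$$
   Context: Reversibility: $K(x,dy)\pi(dx)=K(y,dx)\pi(dy)$. $K^n$ is the $n$-step kernel, $K^n(x,dy)=\int K^{n-1}(x,dz)K(z,dy)$, and $\mu_n(S)=\int\mu_0(dx)K^n(x,S)$. For $\mu\ll\pi$, $\chi(\mu\|\pi):=\big(\int(\frac{d\mu}{d\pi}-1)^2d\pi\big)^{1/2}$ (so $\chi(\mu\|\pi)^2$ is the $\chi^2$-divergence). For a kernel $P$ reversible w.r.t. $\pi$ and $g\in L_2(\pi)$, the Dirichlet form is $\mathcal E_P(g,g)=\frac12\iint(g(x)-g(y))^2P(x,dy)\pi(dx)$. *)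

(* Defs.v *)
From HB Require Import structures.
From mathcomp Require Import all_boot all_order all_algebra.
From mathcomp Require Import all_classical all_reals all_analysis.
Set Implicit Arguments. Unset Strict Implicit. Unset Printing Implicit Defensive.
Import Order.TTheory GRing.Theory Num.Theory.
Local Open Scope classical_set_scope.
Local Open Scope ring_scope.
Local Open Scope ereal_scope.

Section Defs.
Context d (X : measurableType d) (R : realType).

(* Action of the n-step kernel K^n on (extended) functions:
   kiter K n f x = \int K^n(x,dy) f y.
   kiter K 0 f = f ; kiter K (n+1) f x = \int K(x,dz) (kiter K n f) z. *)
Fixpoint kiter (K : R.-ker X ~> X) (n : nat) (f : X -> \bar R) : X -> \bar R :=
  match n with
  | O => f
  | S m => fun x => \int[K x]_z kiter K m f z
  end.

Definition law_n (K : R.-ker X ~> X) (mu0 : {measure set X -> \bar R})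
  (n : nat) (S : set X) : \bar R :=
  \int[mu0]_x kiter K n (fun y => (\1_S y)%:E) x.

Definition is_density (pi : {measure set X -> \bar R}) (nu : set X -> \bar R)
  (h : X -> R) : Prop :=
  measurable_fun [set: X] h /\
  forall A, measurable A -> nu A = \int[pi]_(x in A) (h x)%:E.

(* chi(mu||pi)^2 = \int (dmu/dpi - 1)^2 dpi, where h = dmu/dpi *)
Definition chi2 (pi : {measure set X -> \bar R}) (h : X -> R) : \bar R :=
  \int[pi]_x (((h x - 1) ^+ 2)%R)%:E.

Definition dirichlet_K2 (K : R.-ker X ~> X) (pi : {measure set X -> \bar R})
  (g : X -> R) : \bar R :=
  (2^-1)%:E * \int[pi]_x kiter K 2 (fun y => (((g x - g y) ^+ 2)%R)%:E) x.

(* reversibility: K(x,dy)pi(dx) = K(y,dx)pi(dy), i.e. equality on rectangles *)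
Definition reversible (K : R.-ker X ~> X) (pi : {measure set X -> \bar R}) : Prop :=
  forall A B, measurable A -> measurable B ->
    \int[pi]_(x in A) K x B = \int[pi]_(x in B) K x A.

End Defs.

(* Main.v *)
Require Import Defs.
From HB Require Import structures.
From mathcomp Require Import all_boot all_order all_algebra.
From mathcomp Require Import ring lra.
From mathcomp Require Import all_classical all_reals all_analysis.
Import Order.TTheory GRing.Theory Num.Theory.
Import measurable_realfun.
Local Open Scope classical_set_scope.
Local Open Scope ring_scope.
Local Open Scope ereal_scope.

(* Let h_n be the density of the n-th law. Since K is self-adjoint,
   h_n = K^n h_0 and int h_(n-1) h_(n+1) dpi = int h_n^2 dpi, so that
   chi_n^2 = Var(h_n) = Cov(h_(n-1), h_(n+1)) and Cauchy-Schwarz makes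
   n |-> chi_n^2 log-convex. Its successive ratios are therefore bounded below
   by chi_1^2 / chi_0^2, which equals 1 - E_(K^2)(h_0, h_0) / chi_0^2.
   Everything is done with nonnegative extended-real functions (after replacing
   h_0 by its positive part), so that K acts without integrability conditions. *)

(** * Additive functionals continuous along increasing sequences *)

Section MonotoneFunctionals.
Context {d} {X : measurableType d} {R : realType}.
Implicit Types (f g F : X -> \bar R) (Phi Psi : (X -> \bar R) -> \bar R).

Definition nnmeas f := measurable_fun [set: X] f /\ forall x, 0 <= f x.

(** These properties of integration determine a functional from its values on indicators. Stating
    them abstractly covers weighted and iterated integrals without constructing the measures behind
    them. *)
Record mfunctional Phi : Prop := {
  mfZ : forall r f, (0 <= r)%R -> nnmeas f ->
    Phi (fun x => r%:E * f x) = r%:E * Phi f;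
  mfD : forall f g, nnmeas f -> nnmeas g ->
    Phi (fun x => f x + g x) = Phi f + Phi g;
  mf_lim : forall (f_ : nat -> X -> \bar R) f, (forall n, nnmeas (f_ n)) ->
    (forall x, nondecreasing_seq (f_ ^~ x)) ->
    (forall x, f_ ^~ x @ \oo --> f x) ->
    Phi (f_ n) @[n --> \oo] --> Phi f }.

Lemma nnmeas_indic A : measurable A -> nnmeas (fun x => (\1_A x)%:E).
Proof.
move=> mA; split; last by move=> x; rewrite lee_fin.
by apply/measurable_EFinP; exact: measurable_indic.
Qed.

Lemma nnmeas_cst r : 0 <= r -> nnmeas (fun=> r).
Proof. by move=> r0; split. Qed.

Lemma nnmeasD f g : nnmeas f -> nnmeas g -> nnmeas (fun x => f x + g x).
Proof.
by move=> [mf f0] [mg g0]; split;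
  [exact: emeasurable_funD|move=> x; exact: adde_ge0].
Qed.

Lemma nnmeasM f g : nnmeas f -> nnmeas g -> nnmeas (fun x => f x * g x).
Proof.
by move=> [mf f0] [mg g0]; split;
  [exact: emeasurable_funM|move=> x; exact: mule_ge0].
Qed.

Lemma nnmeasZ r f : 0 <= r -> nnmeas f -> nnmeas (fun x => r * f x).
Proof. by move=> r0; apply: nnmeasM; exact: nnmeas_cst. Qed.

(** The delicate case is [a = +oo], where multiplication is discontinuous at 0. Monotonicity rescues
    it: a zero limit forces every [u n] to vanish, and a positive limit makes the products
    eventually [+oo]. *)
Lemma nd_cvgeZl (a : \bar R) (u : (\bar R)^nat) (l : \bar R) : 0 <= a ->
  (forall n, 0 <= u n) -> nondecreasing_seq u -> u @ \oo --> l ->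
  a * u n @[n --> \oo] --> a * l.
Proof.
move=> a0 u0 ndu ul.
case: a a0 => [a a0|_|//]; first exact: cvgeZl.
have ul_le n : u n <= l.
  rewrite -(cvg_lim (@ereal_hausdorff R) ul).
  by apply: lime_ge; [apply/cvg_ex; exists l|exists n => // m /=; exact: ndu].
have l0 : 0 <= l by exact: le_trans (u0 0%N) (ul_le 0%N).
have [l_eq0|l_neq0] := eqVneq l 0.
  have u_eq0 n : u n = 0 by apply/eqP; rewrite eq_le u0 -l_eq0 ul_le.
  by under eq_fun do rewrite u_eq0; rewrite l_eq0; exact: cvg_cst.
have l_gt0 : 0 < l by rewrite lt0e l_neq0.
rewrite gt0_mulye//.
apply: (cvg_near_cst (+oo : \bar R)).
have u_gt0 : \forall n \near \oo, 0 < u n by exact: (ul _ (open_ereal_gt' l_gt0)).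
by apply: filterS u_gt0 => n un0; rewrite gt0_mulye.
Qed.

Lemma mfunctional_integral (mu : {measure set X -> \bar R}) :
  mfunctional (fun f => \int[mu]_x f x).
Proof.
split.
- by move=> r f r0 [mf f0]; rewrite ge0_integralZl.
- by move=> f g [mf f0] [mg g0]; rewrite ge0_integralD.
- move=> f_ f nnf ndf cf.
  have -> : f = (fun x => limn (f_ ^~ x)).
    by apply/funext => x; apply/esym/cvg_lim.
  apply: cvg_monotone_convergence => //.
  + by move=> n; exact: (nnf n).1.
  + by move=> n x _; exact: (nnf n).2.
Qed.

Lemma mfunctional_weight F Phi : nnmeas F -> mfunctional Phi ->
  mfunctional (fun f => Phi (fun x => F x * f x)).
Proof.
move=> nnF [Z D L]; split.
- move=> r f r0 nnf; rewrite -Z//; last exact: nnmeasM.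
  by congr Phi; apply/funext => x; rewrite muleCA.
- move=> f g nnf nng; rewrite -D; [|exact: nnmeasM..].
  by congr Phi; apply/funext => x; rewrite ge0_muleDr// ?nnf.2 ?nng.2.
- move=> f_ f nnf ndf cf; apply: L.
  + by move=> n; exact: nnmeasM.
  + by move=> x m n mn; rewrite lee_wpmul2l ?nnF.2//; exact: ndf.
  + by move=> x; apply: nd_cvgeZl => //; [exact: nnF.2|move=> n; exact: (nnf n).2].
Qed.

Lemma nnmeas_kernel (K : R.-ker X ~> X) f : nnmeas f ->
  nnmeas (fun x => \int[K x]_y f y).
Proof.
move=> [mf f0]; split; last by move=> x; exact: integral_ge0.
by apply: measurable_fun_integral_kernel => //; exact: measurable_kernel.
Qed.

Lemma mfunctional_kernel (K : R.-ker X ~> X) Phi : mfunctional Phi ->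
  mfunctional (fun f => Phi (fun x => \int[K x]_y f y)).
Proof.
move=> [Z D L]; split.
- move=> r f r0 nnf; rewrite -Z//; last exact: nnmeas_kernel.
  by congr Phi; apply/funext => x; rewrite (mfZ _ (mfunctional_integral _)).
- move=> f g nnf nng; rewrite -D; [|exact: nnmeas_kernel..].
  by congr Phi; apply/funext => x; rewrite (mfD _ (mfunctional_integral _)).
- move=> f_ f nnf ndf cf; apply: L.
  + by move=> n; exact: nnmeas_kernel.
  + move=> x m n mn; apply: ge0_le_integral => //.
    * by move=> y _; exact: (nnf m).2.
    * exact: (nnf m).1.
    * exact: (nnf n).1.
    * by move=> y _; exact: ndf.
  + by move=> x; exact: (mf_lim _ (mfunctional_integral (K x))).
Qed.

Import HBNNSimple.

(** The standard machine: agreement passes from indicators to simple functions by linearity, then to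
    nonnegative measurable functions by increasing approximation. *)
Lemma mfunctional_unique Phi Psi : mfunctional Phi -> mfunctional Psi ->
  (forall A, measurable A ->
    Phi (fun x => (\1_A x)%:E) = Psi (fun x => (\1_A x)%:E)) ->
  forall f, nnmeas f -> Phi f = Psi f.
Proof.
move=> mPhi mPsi PhiPsi.
have sum_agree (s : seq R) (A : R -> set X) : (forall r, measurable (A r)) ->
    (forall r, r \in s -> (0 <= r)%R) ->
    let f := fun x => \sum_(r <- s) r%:E * (\1_(A r) x)%:E in
    nnmeas f /\ Phi f = Psi f.
  move=> mA; elim: s => [_|r s IH rs0] /=.
    (* The empty sum is written as 0 times an indicator, so that homogeneity with factor 0 gives the
       value 0 on both sides. *)
    have -> : (fun x : X => \sum_(r <- [::]) r%:E * (\1_(A r) x)%:E) =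
        (fun x => 0%:E * (\1_set0 x)%:E).
      by apply/funext => x; rewrite big_nil mul0e.
    split; first by apply: nnmeasZ => //; exact: nnmeas_indic.
    rewrite (mfZ _ mPhi)// ?(mfZ _ mPsi)// ?mul0e//; exact: nnmeas_indic.
  have r0 : (0 <= r)%R by apply: rs0; rewrite mem_head.
  have [|nns sE] := IH; first by move=> t ts; apply: rs0; rewrite in_cons ts orbT.
  have nnr := nnmeas_indic (A r) (mA r).
  have nnr' : nnmeas (fun x => r%:E * (\1_(A r) x)%:E) by exact: nnmeasZ.
  under eq_fun do rewrite big_cons.
  split; first exact: nnmeasD.
  by rewrite (mfD _ mPhi)// (mfD _ mPsi)// (mfZ _ mPhi)// (mfZ _ mPsi)// sE PhiPsi.
move=> f [mf f0].
pose s := nnsfun_approx measurableT mf.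
have sE n : let g := fun x => (s n x)%:E in nnmeas g /\ Phi g = Psi g.
  have -> : (fun x => (s n x)%:E) =
      (fun x => \sum_(r <- finmap.enum_fset (fset_set (range (s n))))
        r%:E * (\1_(s n @^-1` [set r]) x)%:E).
    apply/funext => x; rewrite [in LHS]fimfunE fsbig_finite//= -sumEFin.
    by apply: eq_bigr => r _; rewrite EFinM.
  apply: (sum_agree _ (fun r => s n @^-1` [set r])) => [//|r].
  by rewrite in_fset_set// inE => -[x _ <-].
have cf x : (s n x)%:E @[n --> \oo] --> f x by apply: cvg_nnsfun_approx.
have nds x : nondecreasing_seq (fun n => (s n x)%:E).
  by move=> m n mn; rewrite lee_fin; exact/lefP/nd_nnsfun_approx.
have := mf_lim _ mPhi _ _ (fun n => (sE n).1) nds cf.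
have := mf_lim _ mPsi _ _ (fun n => (sE n).1) nds cf.
under eq_fun do rewrite -(sE _).2.
by move=> c1 c2; exact: (cvg_unique _ c2 c1).
Qed.

End MonotoneFunctionals.

(** * Iterates of a kernel acting on functions *)

Section KernelIterates.
Context {d} {X : measurableType d} {R : realType}.
Variable K : R.-ker X ~> X.
Implicit Type f : X -> \bar R.

Lemma nnmeas_kiter n f : nnmeas f -> nnmeas (kiter K n f).
Proof. by move=> nnf; elim: n => //= n; exact: nnmeas_kernel. Qed.

(** [kiter] adds steps on the outside; moving iterates across an integral also requires peeling them
    off on the inside. *)
Lemma kiterSr n f : kiter K n.+1 f = kiter K n (fun x => \int[K x]_y f y).
Proof. by elim: n => //= n <-. Qed.

End KernelIterates.

(** * Self-adjointness, stationarity and Jensen's inequality *)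

Section ReversibleKernel.
Context {d} {X : measurableType d} {R : realType}.
Variables (K : R.-pker X ~> X) (pi : {measure set X -> \bar R}).
Implicit Types f g h : X -> \bar R.

Lemma kiter1 n : kiter K n (fun=> 1) = fun=> 1.
Proof.
elim: n => //= n ->; apply/funext => x.
by rewrite integral_cst// mul1e prob_kernel.
Qed.

Hypothesis Krev : reversible K pi.

(** On indicators this is reversibility itself. Each side is a monotone functional of [f] and of [g]
    separately, so two uses of [mfunctional_unique] extend it to all nonnegative functions. *)
Lemma reversible_symmetric f g : nnmeas f -> nnmeas g ->
  \int[pi]_x (f x * \int[K x]_y g y) = \int[pi]_x (g x * \int[K x]_y f y).
Proof.
have mint := mfunctional_integral pi.
have mL F : nnmeas F -> mfunctional (fun g' => \int[pi]_x (F x * \int[K x]_y g' y)).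
  by move=> nnF; exact: (mfunctional_kernel K _ (mfunctional_weight F _ nnF mint)).
have mR F : nnmeas F -> mfunctional (fun g' => \int[pi]_x (g' x * \int[K x]_y F y)).
  move=> nnF; have nnKF := nnmeas_kernel K F nnF.
  have := mfunctional_weight _ _ nnKF mint.
  by congr mfunctional; apply/funext => g'; apply: eq_integral => x _; rewrite muleC.
move=> nnf nng.
apply: (mfunctional_unique _ _ (mL f nnf) (mR f nnf) _ g nng) => B mB.
have nnB := nnmeas_indic (R := R) B mB.
apply: (mfunctional_unique _ _ (mR _ nnB) (mL _ nnB) _ f nnf) => A mA.
have intK C D : measurable C -> measurable D ->
    \int[pi]_x ((\1_C x)%:E * \int[K x]_y (\1_D y)%:E) = \int[pi]_(x in C) K x D.
  move=> mC mD; rewrite [RHS]integral_mkcond; apply: eq_integral => x _.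
  by rewrite integral_indic// setIT epatch_indic muleC.
by rewrite !intK// Krev.
Qed.

Lemma kiter_symmetric n f g : nnmeas f -> nnmeas g ->
  \int[pi]_x (f x * kiter K n g x) = \int[pi]_x (kiter K n f x * g x).
Proof.
elim: n f g => // n IH f g nnf nng.
rewrite reversible_symmetric//; last exact: nnmeas_kiter.
rewrite kiterSr -IH//; last exact: nnmeas_kernel.
by apply: eq_integral => x _; rewrite muleC.
Qed.

(** Stationarity of [pi]: pair with the constant 1, which the Markov kernel fixes. *)
Lemma integral_kiter n f : nnmeas f ->
  \int[pi]_x kiter K n f x = \int[pi]_x f x.
Proof.
move=> nnf; have := kiter_symmetric n _ _ (nnmeas_cst 1 lee01) nnf.
rewrite kiter1.
by under eq_integral do rewrite mul1e; under [RHS]eq_integral do rewrite mul1e.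
Qed.

(** One of the two extra applications of [K] moves to the other factor by self-adjointness. *)
Lemma integral_kiter_sqr n f : nnmeas f ->
  \int[pi]_x (kiter K n f x * kiter K n.+2 f x) =
  \int[pi]_x (kiter K n.+1 f x * kiter K n.+1 f x).
Proof.
move=> nnf; have nnn := nnmeas_kiter K n _ nnf.
rewrite reversible_symmetric//.
exact: nnmeas_kernel.
Qed.

Lemma sqr_integral_le (P : {measure set X -> \bar R}) f :
  P [set: X] = 1 -> nnmeas f ->
  (\int[P]_x f x) * (\int[P]_x f x) <= \int[P]_x (f x * f x).
Proof.
move=> P1 nnf; have [mf f0] := nnf; have [mff ff0] := nnmeasM _ _ nnf nnf.
have If0 : 0 <= \int[P]_x f x by exact: integral_ge0.
(* If the mean is infinite, [f <= 1 + f * f] makes the second moment infinite too. *)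
have [fy|fNy] := eqVneq (\int[P]_x f x) +oo.
  have : \int[P]_x f x <= \int[P]_x (1 + f x * f x).
    apply: ge0_le_integral => //.
    - exact: emeasurable_funD.
    - move=> x _; case: (f x) (f0 x) => [r r0|_|//].
        by rewrite -EFinM -EFinD lee_fin; nra.
      by rewrite mulyy addey// leey.
  rewrite fy mulyy ge0_integralD// integral_cst// mul1e [X in X + _]P1.
  by case: (\int[P]_x (f x * f x)).
have Ifin : \int[P]_x f x \is a fin_num by rewrite ge0_fin_numE// ltey.
set c := fine (\int[P]_x f x).
have c0 : (0 <= c)%R by exact: fine_ge0.
have Ec : \int[P]_x f x = c%:E by rewrite fineK.
(* This integrates [(c - f)^2 >= 0] with [c] the mean, rearranged without subtraction so that it
   also holds where [f] is infinite. *)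
have : \int[P]_x ((2 * c)%:E * f x) <= \int[P]_x ((c * c)%:E + f x * f x).
  apply: ge0_le_integral => //.
  - by move=> x _; rewrite mule_ge0// lee_fin mulr_ge0.
  - exact: measurable_funeM.
  - exact: emeasurable_funD.
  - move=> x _; case: (f x) (f0 x) => [r r0|_|//].
      rewrite -!EFinM -EFinD lee_fin -subr_ge0.
      by rewrite (_ : _ - _ = (c - r) ^+ 2)%R ?sqr_ge0//; ring.
    by rewrite mulyy addey// leey.
rewrite ge0_integralZl// ?lee_fin ?mulr_ge0// Ec ge0_integralD//; last first.
  by move=> x _; rewrite lee_fin mulr_ge0.
rewrite integral_cst// [X in _ * X + _]P1 mule1.
rewrite -!EFinM.
case: (\int[P]_x (f x * f x)) => [r||]; rewrite ?leey//.
by rewrite -EFinD !lee_fin; lra.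
Qed.

End ReversibleKernel.

(** * Measurability of two-step integrals depending on the starting point *)

Section TwoStepMeasurability.
Context {d} {X : measurableType d} {R : realType}.
Variables (K : R.-pker X ~> X).

(** The integrand itself varies with [x], so the last step is integrated on the product space:
    [v (x, z)] integrates [u (x, y)] over [K z], through a kernel that reads only the second
    coordinate. Integrating [v (x, z)] over [K x] then gives the claim. *)
Lemma measurable_kiter2 (u : X * X -> \bar R) :
  measurable_fun [set: X * X] u -> (forall p, 0 <= u p) ->
  measurable_fun [set: X] (fun x => kiter K 2 (fun y => u (x, y)) x).
Proof.
move=> mu u0 /=.
pose v (p : X * X) := \int[kernel.kernel_snd (T0 := X) K p]_y u (p.1, y).
have mv : measurable_fun [set: X * X] v.
  apply: (measurable_fun_integral_sfinite_kernel
    (fun q : (X * X) * X => u (q.1.1, q.2)) (kernel.kernel_snd (T0 := X) K)) => //.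
  apply: measurableT_comp => //; apply: measurable_fun_pair => //.
  by apply: measurableT_comp.
apply: (measurable_fun_integral_sfinite_kernel v K) => // p.
by apply: integral_ge0.
Qed.
End TwoStepMeasurability.

(** * The chi-square divergence as a variance *)

Section ChiSquare.
Context {d} {X : measurableType d} {R : realType}.
Variables (P : probability X R).
Implicit Types f g h : X -> R.

Lemma Lfun2P f : measurable_fun [set: X] f ->
  \int[P]_x (f x * f x)%:E < +oo -> f \in Lfun P 2%:E.
Proof.
move=> mf f2; rewrite inE; apply/andP; split; rewrite inE//=.
rewrite /finite_norm unlock poweR_lty//.
apply: le_lt_trans f2; rewrite le_eqVlt; apply/orP; left; apply/eqP.
apply: eq_integral => x _ /=.
by rewrite powR_mulrn// real_normK ?num_real// expr2.
Qed.

Lemma chi2_variance f : \int[P]_x (f x)%:E = 1 -> chi2 P f = 'V_P[f].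
Proof.
move=> f1; have Ef : 'E_P[f] = 1 by rewrite unlock.
rewrite /variance covariance.unlock Ef expectation.unlock; apply: eq_integral => x _.
by rewrite /= expr2.
Qed.

Lemma chi2E f : f \in Lfun P 2%:E -> \int[P]_x (f x)%:E = 1 ->
  chi2 P f = \int[P]_x (f x * f x)%:E - 1.
Proof.
move=> f2 f1; rewrite chi2_variance// varianceE// !expectation.unlock f1 expe2 mule1.
by congr (_ - _); apply: eq_integral => x _; rewrite /= expr2.
Qed.

(** With all means equal to 1, the last hypothesis says that the covariance of [f] and [h] is the
    variance of [g]; Cauchy-Schwarz bounds that covariance. *)
Lemma chi2_log_convex f g h :
  f \in Lfun P 2%:E -> g \in Lfun P 2%:E -> h \in Lfun P 2%:E ->
  \int[P]_x (f x)%:E = 1 -> \int[P]_x (g x)%:E = 1 -> \int[P]_x (h x)%:E = 1 ->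
  \int[P]_x (f x * h x)%:E = \int[P]_x (g x * g x)%:E ->
  chi2 P g * chi2 P g <= chi2 P f * chi2 P h.
Proof.
move=> f2 g2 h2 f1 g1 h1 fhgg.
have Pfin : P setT \is a fin_num := fin_num_measure P _ measurableT.
have covE : covariance P f h = 'V_P[g].
  rewrite /variance !covarianceE ?Lfun2_mul_Lfun1 ?Lfun_subset12//.
  have -> : 'E_P[(f * h)%R] = 'E_P[(g * g)%R] by rewrite unlock.
  by rewrite expectation.unlock f1 g1 h1.
have := covariance_le f2 h2; rewrite covE !chi2_variance// => le_gfh.
(* [le_gfh] has a product of square roots on the right; writing the target as its square reduces the
   goal to multiplying [le_gfh] by itself. *)
rewrite -[leRHS](sqr_sqrte (mule_ge0 (variance_ge0 _ _) (variance_ge0 _ _))).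
rewrite sqrteM ?variance_ge0// expe2 lee_pmul ?variance_ge0//.
Qed.

End ChiSquare.

(** * Densities of the successive laws *)

Section DensityEvolution.
Context {d} {X : measurableType d} {R : realType}.
Variables (K : R.-pker X ~> X) (pi : probability X R) (h : X -> R).
Hypotheses (Krev : reversible K pi) (mh : measurable_fun [set: X] h).
Hypotheses (h0 : forall x, (0 <= h x)%R) (h1 : \int[pi]_x (h x)%:E = 1).
Hypothesis h2 : \int[pi]_x (h x * h x)%:E < +oo.

Let H n := kiter K n (fun x => (h x)%:E).
(** [H n] may be infinite on a [pi]-null set; [fine] returns 0 there, which changes no integral
    against [pi]. *)
Definition step_density n x : R := fine (H n x).
Let k := step_density.

Let nnH n : nnmeas (H n).
Proof.
apply: nnmeas_kiter; split=> [|x]; first exact/measurable_EFinP.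
by rewrite lee_fin.
Qed.

Let H1 n : \int[pi]_x H n x = 1.
Proof. by rewrite integral_kiter//; exact: (nnH 0). Qed.

Lemma measurable_step_density n : measurable_fun [set: X] (k n).
Proof. by apply: measurableT_comp => //; exact: (nnH n).1. Qed.

Let kH n : {ae pi, forall x, (k n x)%:E = H n x}.
Proof.
have : pi.-integrable setT (H n).
  apply/integrableP; split; first exact: (nnH n).1.
  under eq_integral do rewrite gee0_abs ?(nnH n).2//.
  by rewrite H1 ltry.
move=> /(integrable_ae measurableT); apply: filterS => x Hfin.
by rewrite /k /step_density fineK// Hfin.
Qed.

Lemma integral_step_density n A : measurable A ->
  \int[pi]_(x in A) (k n x)%:E = \int[pi]_(x in A) H n x.
Proof.
move=> mA; apply: ae_eq_integral => //.
- by apply/measurable_EFinP; apply: measurable_funTS; exact: measurable_step_density.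
- by apply: measurable_funTS; exact: (nnH n).1.
- by apply: filterS (kH n) => x kHx _.
Qed.

Let k1 n : \int[pi]_x (k n x)%:E = 1.
Proof. by rewrite integral_step_density. Qed.

Let kk m n : \int[pi]_x (k m x * k n x)%:E = \int[pi]_x (H m x * H n x).
Proof.
apply: ae_eq_integral => //.
- by apply/measurable_EFinP; apply: measurable_funM; exact: measurable_step_density.
- exact: (nnmeasM _ _ (nnH m) (nnH n)).1.
- by apply: filterS2 (kH m) (kH n) => x mx nx _; rewrite EFinM mx nx.
Qed.

(** [K] contracts the L2 norm: Jensen under each [K x], then stationarity applied to the square of
    [H n]. Hence all the densities stay square integrable. *)
Let H2_le n : \int[pi]_x (H n.+1 x * H n.+1 x) <= \int[pi]_x (H n x * H n x).
Proof.
rewrite -(integral_kiter _ _ Krev 1 (fun x => H n x * H n x)); last exact: nnmeasM.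
apply: ge0_le_integral => //.
- by move=> x _; rewrite mule_ge0 ?(nnH n.+1).2.
- exact: (nnmeasM _ _ (nnH n.+1) (nnH n.+1)).1.
- exact: (nnmeas_kiter K 1 _ (nnmeasM _ _ (nnH n) (nnH n))).1.
- by move=> x _; apply: sqr_integral_le; [exact: prob_kernel|exact: nnH].
Qed.

Let H2 n : \int[pi]_x (H n x * H n x) < +oo.
Proof. by elim: n => // n; apply: le_lt_trans; exact: H2_le. Qed.

Let k2 n : k n \in Lfun pi 2%:E.
Proof. by apply: Lfun2P; [exact: measurable_step_density|rewrite kk]. Qed.

Lemma chi2_step_densityE n : chi2 pi (k n) = \int[pi]_x (H n x * H n x) - 1.
Proof. by rewrite chi2E// kk. Qed.

Lemma chi2_step_density_fin_num n : chi2 pi (k n) \is a fin_num.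
Proof.
rewrite chi2_step_densityE fin_numB andbT ge0_fin_numE//.
by apply: integral_ge0 => x _; rewrite mule_ge0// ?(nnH n).2.
Qed.

Lemma chi2_step_density_log_convex n :
  chi2 pi (k n.+1) * chi2 pi (k n.+1) <= chi2 pi (k n) * chi2 pi (k n.+2).
Proof.
apply: (chi2_log_convex _ _ _ _ (k2 n) (k2 n.+1) (k2 n.+2) (k1 n) (k1 n.+1) (k1 n.+2)).
by rewrite !kk; exact: (integral_kiter_sqr _ _ Krev n _ (nnH 0)).
Qed.

(** Expanding [(h x - h y)^2], stationarity makes both square terms integrate to the second moment
    of [h], and self-adjointness turns the cross term into that of [K h]. Thus the form is the
    difference of these two moments. *)
Lemma dirichlet_K2_chi2 : dirichlet_K2 K pi h + chi2 pi (k 1) = chi2 pi h.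
Proof.
pose u (p : X * X) : R := ((h p.1 - h p.2) ^+ 2)%R.
have mu_ : measurable_fun [set: X * X] u.
  by apply: measurable_funX; apply: measurable_funB; apply: measurableT_comp.
have u0 p : (0 <= u p)%R by exact: sqr_ge0.
have nnu x : nnmeas (fun y => (u (x, y))%:E).
  split; last by move=> y; rewrite lee_fin.
  by apply/measurable_EFinP; apply: measurableT_comp.
pose G x := kiter K 2 (fun y => (u (x, y))%:E) x.
have nnG : nnmeas G.
  split; last by move=> x; exact: (nnmeas_kiter K 2 _ (nnu x)).2.
  apply: (measurable_kiter2 K (fun p => (u p)%:E)).
    exact/measurable_EFinP.
  by move=> p; rewrite lee_fin.
have mK2 x : mfunctional (fun f => kiter K 2 f x).
  exact: (mfunctional_kernel K _ (mfunctional_integral (K x))).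
have K2D x f g : nnmeas f -> nnmeas g ->
  kiter K 2 (fun y => f y + g y) x = kiter K 2 f x + kiter K 2 g x.
  exact: (mfD _ (mK2 x)).
have K2Z x r f : (0 <= r)%R -> nnmeas f ->
  kiter K 2 (fun y => r%:E * f y) x = r%:E * kiter K 2 f x.
  exact: (mfZ _ (mK2 x)).
pose Q x := H 0 x * H 0 x.
have nnQ : nnmeas Q by exact: nnmeasM.
(* The cross term is kept on the left, so that every term is nonnegative and additivity needs no
   integrability. *)
have square_expansion x : G x + 2%:E * (H 0 x * H 2 x) = Q x + kiter K 2 Q x.
  pose c := (h x * h x)%R.
  have c0 : (0 <= c)%R by exact: mulr_ge0.
  have hx0 : (0 <= 2 * h x)%R by exact: mulr_ge0.
  have nnhH : nnmeas (fun y => (2 * h x)%:E * H 0 y) by exact: nnmeasZ.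
  have nnc : nnmeas ((fun=> c%:E * 1) : X -> \bar R).
    by split=> // y; rewrite mule1 lee_fin.
  have -> : 2%:E * (H 0 x * H 2 x) = kiter K 2 (fun y => (2 * h x)%:E * H 0 y) x.
    by rewrite (K2Z x _ _ hx0 (nnH 0)) muleA EFinM.
  have -> : Q x = kiter K 2 (fun=> c%:E * 1) x.
    by rewrite (K2Z x _ _ c0 (nnmeas_cst 1 lee01)) kiter1 mule1.
  rewrite /G -(K2D x _ _ (nnu x) nnhH) -(K2D x _ _ nnc nnQ).
  congr (kiter K 2 _ x); apply/funext => y.
  by rewrite mule1 -!EFinM -!EFinD; congr EFin; rewrite /u /c /=; ring.
have intE : \int[pi]_x G x + 2%:E * \int[pi]_x (H 1 x * H 1 x) =
    2%:E * \int[pi]_x Q x.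
  have nnHH m n : nnmeas (fun x => H m x * H n x) by exact: nnmeasM.
  have intD f g : nnmeas f -> nnmeas g ->
    \int[pi]_x (f x + g x) = \int[pi]_x f x + \int[pi]_x g x.
    exact: (mfD _ (mfunctional_integral pi)).
  have intZ r f : (0 <= r)%R -> nnmeas f ->
    \int[pi]_x (r%:E * f x) = r%:E * \int[pi]_x f x.
    exact: (mfZ _ (mfunctional_integral pi)).
  rewrite -integral_kiter_sqr; [|exact: Krev|exact: (nnH 0)].
  rewrite -intZ; [|by []|exact: (nnHH 0%N 2%N)].
  rewrite -(intD G (fun x => 2%:E * (H 0 x * H 2 x))); [|exact: nnG|exact: nnmeasZ].
  under eq_integral do rewrite square_expansion.
  rewrite (intD Q (kiter K 2 Q) nnQ); last exact: nnmeas_kiter.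
  by rewrite integral_kiter// mule_natl mule2n.
(* [k 0] is convertible to [h], which gives both chi-square terms the same shape. *)
change (2^-1%:E * \int[pi]_x G x + chi2 pi (k 1) = chi2 pi (k 0)).
rewrite !chi2_step_densityE.
have fin n : \int[pi]_x (H n x * H n x) \is a fin_num.
  rewrite ge0_fin_numE//; apply: integral_ge0 => x _.
  by rewrite mule_ge0// ?(nnH n).2.
(* By [intE] this integral is at most twice the second moment of [h]; once all terms are finite, the
   identity can be solved in [R]. *)
have Ginty : \int[pi]_x G x \is a fin_num.
  rewrite ge0_fin_numE; last by apply: integral_ge0 => x _; exact: nnG.2.
  apply: (@le_lt_trans _ _ (2%:E * \int[pi]_x Q x)).
    rewrite -intE leeDl// mule_ge0// integral_ge0// => x _.
    by rewrite mule_ge0 ?(nnH 1).2.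
  by rewrite -(fineK (fin 0%N)) -EFinM ltry.
move: intE; rewrite -(fineK (fin 0%N)) -(fineK (fin 1%N)) -(fineK Ginty).
rewrite -!EFinM -!EFinD => -[e]; congr EFin; lra.
Qed.

(** Write integration against [mu0] as integration of [h] times the integrand against [pi], then
    move [K^n] from the indicator to [h] by self-adjointness. *)
Lemma is_density_step_density (mu0 : probability X R) n :
  is_density pi mu0 h -> is_density pi (law_n K mu0 n) (k n).
Proof.
move=> [_ hE]; split=> [|A mA]; first exact: measurable_step_density.
rewrite integral_step_density// /law_n.
have nnA : nnmeas (fun x => (\1_A x)%:E : \bar R) by exact: nnmeas_indic.
have -> : \int[mu0]_x kiter K n (fun y => (\1_A y)%:E) x =
    \int[pi]_x (H 0 x * kiter K n (fun y => (\1_A y)%:E) x).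
  apply: (mfunctional_unique _ _ (mfunctional_integral mu0)
    (mfunctional_weight _ _ (nnH 0) (mfunctional_integral pi))).
    move=> B mB; rewrite integral_indic// setIT; apply: (eq_trans (hE B mB)).
    rewrite integral_mkcond.
    by apply: eq_integral => x _; rewrite epatch_indic.
  exact: nnmeas_kiter.
rewrite kiter_symmetric// [RHS]integral_mkcond.
by apply: eq_integral => x _; rewrite epatch_indic.
Qed.

End DensityEvolution.

(** * Independence of the chosen version of the density *)

Section AlmostEverywhere.
Context {d} {X : measurableType d} {R : realType}.
Implicit Types (mu : {measure set X -> \bar R}) (f g : X -> \bar R).

Lemma ge0_integral_eq0_ae mu f : nnmeas f -> \int[mu]_x f x = 0 ->
  {ae mu, forall x, f x = 0}.
Proof.
move=> [mf f0] If0.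
have : ae_eq mu setT f (cst 0).
  apply/ae_eq_integral_abs => //.
  by under eq_integral do rewrite gee0_abs//.
by apply: filterS => x; exact.
Qed.

(** The hypothesis says that [N] has mass 0 after [n] steps from [x]. In the induction, a vanishing
    integral of a nonnegative function passes this on to [K x]-almost every next state. *)
Lemma kiter_eq_outside (K : R.-ker X ~> X) n (N : set X) f g x :
  measurable N -> nnmeas f -> nnmeas g -> (forall y, ~ N y -> f y = g y) ->
  kiter K n (fun y => (\1_N y)%:E) x = 0 -> kiter K n f x = kiter K n g x.
Proof.
move=> mN nnf nng fg; elim: n x => [x|n IH x] /=.
  rewrite indicE; have [_ [] /eqP|xN _] := boolP (x \in N); first by rewrite oner_eq0.
  by apply: fg; rewrite -notin_setE.
have nn1 : nnmeas (fun y => (\1_N y)%:E : \bar R) by exact: nnmeas_indic.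
move=> /(ge0_integral_eq0_ae _ _ (nnmeas_kiter K n _ nn1)) N0; apply: ae_eq_integral => //.
- exact: (nnmeas_kiter K n f nnf).1.
- exact: (nnmeas_kiter K n g nng).1.
- by apply: filterS N0 => y yN _; exact: IH.
Qed.

Lemma ae_eq_dirichlet_K2 (K : R.-pker X ~> X) (pi : {measure set X -> \bar R})
    (f g : X -> R) : reversible K pi ->
  measurable_fun [set: X] f -> measurable_fun [set: X] g ->
  {ae pi, forall x, f x = g x} -> dirichlet_K2 K pi f = dirichlet_K2 K pi g.
Proof.
move=> Krev mf mg [N [mN N0 fg]].
have fgN y : ~ N y -> f y = g y by move=> Ny; apply: contrapT => fgy; exact/Ny/fg.
have nn1N : nnmeas (fun y => (\1_N y)%:E : \bar R) by exact: nnmeas_indic.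
have mu (h : X -> R) : measurable_fun [set: X] h ->
    measurable_fun [set: X * X] (fun p : X * X => ((h p.1 - h p.2) ^+ 2)%:E)%R.
  move=> mh; apply/measurable_EFinP; apply: measurable_funX.
  by apply: measurable_funB; apply: measurableT_comp.
have nnu (h : X -> R) x : measurable_fun [set: X] h ->
    nnmeas (fun y => ((h x - h y) ^+ 2)%:E)%R.
  move=> mh; split; last by move=> y; rewrite lee_fin sqr_ge0.
  by apply/measurable_EFinP; apply: measurable_funX; exact: measurable_funB.
have mk (h : X -> R) : measurable_fun [set: X] h ->
    measurable_fun [set: X] (fun x => kiter K 2 (fun y => ((h x - h y) ^+ 2)%:E)%R x).
  move=> mh; apply: (measurable_kiter2 K (fun p : X * X => ((h p.1 - h p.2) ^+ 2)%:E)%R).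
    exact: mu.
  by move=> p; rewrite lee_fin sqr_ge0.
(* By stationarity the integral of the two-step mass of [N] is [pi N], which is 0. Starting points
   in [N] itself are excluded by [Nae]. *)
have N2 : {ae pi, forall x, kiter K 2 (fun y => (\1_N y)%:E) x = 0}.
  apply: ge0_integral_eq0_ae; first exact: nnmeas_kiter.
  by rewrite integral_kiter// integral_indic// setIT.
have Nae : {ae pi, forall x, ~ N x} by exists N; split => // x /contrapT.
suff fg_int : \int[pi]_x kiter K 2 (fun y => ((f x - f y) ^+ 2)%:E)%R x =
    \int[pi]_x kiter K 2 (fun y => ((g x - g y) ^+ 2)%:E)%R x.
  by rewrite /dirichlet_K2 fg_int.
apply: (ae_eq_integral _ _ measurableT (mk f mf) (mk g mg)).
apply: filterS2 N2 Nae => x x2 xN _.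
apply: (@kiter_eq_outside K 2 N _ _ x mN (nnu f x mf) (nnu g x mg) _ x2).
by move=> y yN; rewrite !fgN.
Qed.

(** On the set [N] where [h] is negative, the integral of [h] is [mu N], hence nonnegative; so [h]
    would have to vanish almost everywhere on [N]. *)
Lemma density_ae_ge0 (pi mu : {measure set X -> \bar R}) (h : X -> R) :
  is_density pi mu h -> {ae pi, forall x, (0 <= h x)%R}.
Proof.
move=> [mh hE].
pose N := h @^-1` `]-oo, 0%R[.
have mN : measurable N by rewrite -[N]setTI; exact: mh.
have mhN : measurable_fun N (fun x => (h x)%:E).
  by apply/measurable_EFinP; exact: measurable_funTS.
have : ae_eq pi N (fun x => (h x)%:E) (cst 0).
  apply/ae_eq_integral_abs => //.
  apply/eqP; rewrite eq_le integral_ge0 ?andbT// -oppe_ge0 -integral_ge0N//.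
  have : 0 <= \int[pi]_(x in N) (h x)%:E by rewrite -(hE N mN).
  move=> /le_trans; apply.
  rewrite le_eqVlt; apply/orP; left; apply/eqP; apply: eq_integral => x.
  by rewrite inE /N/= in_itv/= => hx; rewrite ltr0_norm// opprK.
apply: filterS => x /=; rewrite /N /= in_itv /= => hx0.
rewrite leNgt; apply/negP => hx.
by have [] := hx0 hx; move: (hx) => /[swap] ->; rewrite ltxx.
Qed.

End AlmostEverywhere.

(** * Geometric lower bounds and the final estimate *)

(** The ratio [r] of the first two terms equals [1 - e / a 0], and log-convexity keeps later ratios
    at least [r]. If [a 0] or [r] is 0, the bound is immediate. *)
Lemma log_convex_geometric (R : realFieldType) (a : nat -> R) (e : R) :
  (forall n, 0 <= a n)%R -> (forall n, a n.+1 * a n.+1 <= a n * a n.+2)%R ->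
  (e + a 1%N = a 0%N)%R -> forall n, (a 0%N * (1 - e / a 0%N) ^+ n <= a n)%R.
Proof.
move=> a_ge0 a_cvx ea n.
have [a0|a0] := eqVneq (a 0%N) 0%R; first by rewrite a0 mul0r.
have a0_gt0 : (0 < a 0%N)%R by rewrite lt0r a0 a_ge0.
have -> : (1 - e / a 0%N = a 1%N / a 0%N)%R by rewrite -ea in a0 *; field.
set r := (a 1%N / a 0%N)%R.
have r_ge0 : (0 <= r)%R by rewrite divr_ge0.
have [r0|r_neq0] := eqVneq r 0%R.
  by rewrite r0 expr0n; case: n => [|n]; rewrite ?mulr1 ?mulr0.
have r_gt0 : (0 < r)%R by rewrite lt0r r_neq0.
(* Positivity joins the induction because the ratio bound at the next index is obtained by
   cancelling [a n]. *)
suff [] : (0 < a n)%R /\ (a n * r <= a n.+1)%R /\ (a 0%N * r ^+ n <= a n)%R by move=> _ [].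
elim: n => [|n [an_gt0 [an_r IH]]].
  by split=> //; rewrite expr0 mulr1 /r mulrCA divff// mulr1.
have an1_gt0 : (0 < a n.+1)%R by exact: lt_le_trans (mulr_gt0 an_gt0 r_gt0) an_r.
split=> //; split; last first.
  by rewrite exprSr mulrA; apply: le_trans an_r; rewrite ler_wpM2r.
rewrite -(ler_pM2l an_gt0); apply: le_trans (a_cvx n).
by rewrite mulrCA ler_wpM2l// ltW.
Qed.

Theorem theorem4 (d : measure_display) (X : measurableType d) (R : realType)
  (K : R.-pker X ~> X) (pi : probability X R) (mu0 : probability X R)
  (h0 : X -> R) :
  reversible K pi ->
  is_density pi mu0 h0 ->
  chi2 pi h0 < +oo ->
  forall n : nat,
    exists hn : X -> R,
      is_density pi (law_n K mu0 n) hn /\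
      ((fine (chi2 pi h0) *
          (1 - fine (dirichlet_K2 K pi h0) / fine (chi2 pi h0)) ^+ n)%R)%:E
        <= chi2 pi hn.
Proof.
move=> Krev dens0 chi2_lty n.
have [mh0 _] := dens0.
(* A density may be negative on a null set, whereas the nonnegative calculus needs a pointwise
   sign. *)
pose h x := Num.max (h0 x) 0%R.
have mh : measurable_fun [set: X] h by exact: measurable_maxr.
have h_ge0 x : (0 <= h x)%R by rewrite le_max lexx orbT.
have hh0 : {ae pi, forall x, h0 x = h x}.
  by apply: filterS (density_ae_ge0 _ _ _ dens0) => x h0x; rewrite /h max_l.
have dens : is_density pi mu0 h.
  split=> // A mA; rewrite (dens0.2 A mA); apply: ae_eq_integral => //.
  - by apply/measurable_EFinP; exact: measurable_funTS.
  - by apply/measurable_EFinP; exact: measurable_funTS.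
  - by apply: filterS hh0 => x -> _.
have h_int : \int[pi]_x (h x)%:E = 1.
  by rewrite -(dens.2 _ measurableT); exact: probability_setT.
have chi2E0 : chi2 pi h0 = chi2 pi h.
  apply: ae_eq_integral => //.
  - by apply/measurable_EFinP; apply: measurable_funX; exact: measurable_funB.
  - by apply/measurable_EFinP; apply: measurable_funX; exact: measurable_funB.
  - by apply: filterS hh0 => x -> _.
have h_sqr : \int[pi]_x (h x * h x)%:E < +oo.
  (* The gap between the integrands is [(h x - 2)^2]. *)
  have bound : \int[pi]_x (h x * h x)%:E <=
      \int[pi]_x (2%:E * ((h x - 1) ^+ 2)%:E + 2%:E).
    apply: ge0_le_integral => //.
    - by move=> x _; rewrite lee_fin mulr_ge0.
    - by apply/measurable_EFinP; exact: measurable_funM.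
    - apply: emeasurable_funD => //; apply: measurable_funeM.
      by apply/measurable_EFinP; apply: measurable_funX; exact: measurable_funB.
    - by move=> x _; rewrite -EFinM -EFinD lee_fin; have := sqr_ge0 (h x - 2); nra.
  have mh1 : measurable_fun [set: X] (fun x => ((h x - 1) ^+ 2)%:E)%R.
    by apply/measurable_EFinP; apply: measurable_funX; exact: measurable_funB.
  have h10 x : 0 <= ((h x - 1) ^+ 2)%:E by rewrite lee_fin sqr_ge0.
  apply: (le_lt_trans bound).
  rewrite ge0_integralD//; [|by move=> x _; rewrite mule_ge0|exact: measurable_funeM].
  rewrite ge0_integralZl// integral_cst// [X in _ + _ * X]probability_setT mule1.
  by rewrite lte_add_pinfty ?ltry// lte_mul_pinfty//; rewrite -[X in X < _]chi2E0.
pose k := step_density K h.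
pose a m := fine (chi2 pi (k m)).
have fin m : chi2 pi (k m) \is a fin_num.
  exact: chi2_step_density_fin_num Krev mh h_ge0 h_int h_sqr m.
have dir : dirichlet_K2 K pi h + chi2 pi (k 1%N) = chi2 pi (k 0%N).
  exact: (dirichlet_K2_chi2 K pi h Krev mh h_ge0 h_int h_sqr).
have dir_fin : dirichlet_K2 K pi h \is a fin_num.
  (* As a summand of a finite sum the form is finite, so taking [fine] of it in the bound loses
     nothing. *)
  by have := fin 0%N; rewrite -dir fin_numD => /andP[].
exists (k n); split.
  exact: (is_density_step_density K pi h Krev mh h_ge0 h_int mu0 n dens).
rewrite chi2E0 (ae_eq_dirichlet_K2 K pi h0 h Krev mh0 mh hh0) -(fineK (fin n)) lee_fin.
apply: (log_convex_geometric R a (fine (dirichlet_K2 K pi h))) => [m|m|].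
- by apply: fine_ge0; apply: integral_ge0 => x _; rewrite lee_fin sqr_ge0.
- have := chi2_step_density_log_convex K pi h Krev mh h_ge0 h_int h_sqr m.
  by rewrite -(fineK (fin m)) -(fineK (fin m.+1)) -(fineK (fin m.+2)) -!EFinM lee_fin.
- by rewrite /a -(fineD dir_fin (fin 1%N)) dir.
Qed.
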